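(* Let $S$ be a preordered semiring of polynomial growth, and let $a,b$ be approximately geometric sequences in $S$ such that $0\ne a_1\sim1$ and $0\neq b_1\sim 1$. Let $\beta,\gamma:\mathbb N\to\mathbb N$ be sequences such that the limits $\lim_{n\to\infty}\frac{\beta_n}{n}$ and $\lim_{n\to\infty}\frac{\gamma_n}{n}$ exist (in $\mathbb R_{\ge0}$). Then (i) $a\circ\beta$ is approximately geometric; (ii) if $\lim_{n\to\infty}\frac{\beta_n}{n}=\lim_{n\to\infty}\frac{\gamma_n}{n}$, then $a\circ\beta\approx a\circ\gamma$; (iii) $a\circ(\beta+\gamma)\approx(a\circ\beta)\odot(a\circ\gamma)$; (iv) $(a\odot b)\circ\beta=(a\circ\beta)\odot(b\circ\beta)$; (v) if $a\lesssim b$, then $a\circ\gamma\lesssim b\circ\gamma$; (vi) if $\lim_{n\to\infty}\frac{\beta_n}{n}=d\in\mathbb N$, then $a\circ\beta\approx a^d$, where $a^d$ is the $d$-fold elementwise power $(a_n^d)_{n\in\mathbb N}$.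
   Context: Semirings are commutative, with $0$ and $1$. A preordered semiring is a semiring $S$ with a reflexive transitive relation $\le$ such that $x\le y$ implies $z+x\le z+y$ and $zx\le zy$ for all $x,y,z\in S$. The relation $\sim$ is the equivalence relation generated by $\le$. A nonzero element $u\in S$ is power universal if $1\le u$ and for all nonzero $x,y\in S$ with $x\le y$ there is $k\in\mathbb N$ with $y\le u^kx$; $S$ is of polynomial growth if it has a power universal element. A power universal element $u$ is fixed (the notions below do not depend on the choice). It is not assumed that $0\le1$. $\mathbb N$ includes $0$. A sublinear sequence is a sequence $(k_n)_{n\in\mathbb N}$ in $\mathbb N$ with $\lim_{n\to\infty}k_n/n=0$. For $a,b\in S^{\mathbb N}$: $(a\odot b)_n=a_nb_n$; $a\lesssim b$ means that there is a sublinear sequence $(k_n)$ with $a_n\le u^{k_n}b_n$ for all $n\in\mathbb N$; $a\approx b$ means $a\lesssim b$ and $b\lesssim a$. $G(s)=(1,s,s^2,\dots)$ for $s\in S$. For $\beta:\mathbb N\to\mathbb N$, $a\circ\beta=(a_{\beta_n})_{n\in\mathbb N}$. A sequence $a\in S^{\mathbb N}$ is approximately geometric if either $a\approx G(0)$, or $a_n\ne0$ for all $n$ and there is a sublinear sequence $(k_n)$ such that for all $t\in\mathbb N_{>0}$ and $n_1,\dots,n_t\in\mathbb N$ both $a_{n_1}\cdots a_{n_t}\le u^{k_{n_1}+\dots+k_{n_t}}a_{n_1+\dots+n_t}$ and $a_{n_1+\dots+n_t}\le u^{k_{n_1}+\dots+k_{n_t}}a_{n_1}\cdots a_{n_t}$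 hold. *)

(* Defs.v *)
From Stdlib Require Import Relation_Operators.
From HB Require Import structures.
From mathcomp Require Import all_boot all_order all_algebra.
From mathcomp Require Import all_classical all_reals all_analysis.
Import numFieldNormedType.Exports.

Set Implicit Arguments.
Unset Strict Implicit.
Unset Printing Implicit Defensive.

Local Open Scope classical_set_scope.
Local Open Scope ring_scope.

Record preordered_semiring (S : comPzSemiRingType) (le : S -> S -> Prop) :
    Prop := PreorderedSemiring {
  preordered_refl : forall x, le x x ;
  preordered_trans : forall x y z, le x y -> le y z -> le x z ;
  preordered_add : forall x y z, le x y -> le (z + x) (z + y) ;
  preordered_mul : forall x y z, le x y -> le (z * x) (z * y) }.

Definition generated_equiv (S : comPzSemiRingType) (le : S -> S -> Prop) :
    S -> S -> Prop :=
  clos_refl_sym_trans S le.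

Record power_universal (S : comPzSemiRingType) (le : S -> S -> Prop) (u : S) :
    Prop := PowerUniversal {
  power_universal_neq0 : u != 0 ;
  power_universal_ge1 : le 1 u ;
  power_universal_bound : forall x y, x != 0 -> y != 0 -> le x y ->
    exists k : nat, le y (u ^+ k * x) }.

(* The value of [b n / n] at [n = 0] is the junk value [0]; it does not affect
   the limit. *)
Definition ratio_cvg (R : realType) (b : nat -> nat) (l : R) : Prop :=
  (fun n => (b n)%:R / n%:R : R) @ \oo --> l.

Definition sublinear (R : realType) (k : nat -> nat) : Prop :=
  ratio_cvg k (0 : R).

Definition asymp_le (R : realType) (S : comPzSemiRingType)
    (le : S -> S -> Prop) (u : S) (a b : nat -> S) : Prop :=
  exists2 k : nat -> nat, sublinear R k & forall n, le (a n) (u ^+ k n * b n).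

Definition asymp_eq (R : realType) (S : comPzSemiRingType)
    (le : S -> S -> Prop) (u : S) (a b : nat -> S) : Prop :=
  asymp_le R le u a b /\ asymp_le R le u b a.

Definition geometric_seq (S : comPzSemiRingType) (s : S) : nat -> S :=
  fun n => s ^+ n.

Definition seq_mul (S : comPzSemiRingType) (a b : nat -> S) : nat -> S :=
  fun n => a n * b n.

Definition approx_geometric (R : realType) (S : comPzSemiRingType)
    (le : S -> S -> Prop) (u : S) (a : nat -> S) : Prop :=
  asymp_eq R le u a (geometric_seq 0) \/
  (forall n, a n != 0) /\
  exists2 k : nat -> nat, sublinear R k &
    forall (t : nat) (m : 'I_t -> nat), (0 < t)%N ->
      le (\prod_(i < t) a (m i))
         (u ^+ (\sum_(i < t) k (m i))%N * a (\sum_(i < t) m i)%N) /\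
      le (a (\sum_(i < t) m i)%N)
         (u ^+ (\sum_(i < t) k (m i))%N * \prod_(i < t) a (m i)).

(* Main.v *)
(**
If [a] is asymptotic to [G(0)], then [a 1] is comparable, up to powers of [u],
both to [0] and to [1], and every two sequences become equivalent.  Otherwise
[a n] lies between [u^-(Cn+C)] and [u^(Cn+C)], so that [a] is Lipschitz on the
logarithmic scale up to a sublinear error: replacing an index [x] by [y] costs
[k x + k y + C (|x - y| + 1)].  Writing [beta n = l n + o(n)] then gives all the
claims.  For (i) one has to bound [beta (m_1 + ... + m_t) - beta m_1 - ... - beta m_t]
by a sum of terms each depending on a single [m_i]; this works because every
sublinear sequence has a subadditive sublinear majorant.
*)
Require Import Defs.
From Stdlib Require Import Operators_Properties.
From mathcomp Require Import all_boot all_order all_algebra.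
From mathcomp Require Import all_classical all_reals all_analysis.
From mathcomp Require Import zify lra.
Import Order.TTheory GRing.Theory Num.Theory numFieldNormedType.Exports.

Set Implicit Arguments.
Unset Strict Implicit.
Unset Printing Implicit Defensive.

Local Open Scope ring_scope.

(** * Limits of ratios and sublinear sequences, in arithmetic form *)

Lemma ratio_cvg_bound (R : realType) (b : nat -> nat) (l : R) :
  ratio_cvg b l ->
  forall N : nat, exists K : nat, forall n,
    N%:R * `|(b n)%:R - l * n%:R| <= n%:R + K%:R.
Proof.
move=> /cvgrPdist_le cvb N.
(* The tolerance uses [N.+1] so that it also makes sense for [N = 0]. *)
have [|M _ HM] := cvb (N.+1%:R^-1); first by rewrite invr_gt0 ltr0n.
pose g n := N%:R * `|(b n)%:R - l * n%:R|.
(* The additive constant [K] absorbs the finitely many indices up to [M], among them [0], where the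
   quotient is a default value. *)
have [K HK] : exists K : nat, forall n, (n < M.+1)%N -> g n <= K%:R.
  elim: M.+1 => [|m [K HK]]; first by exists 0%N.
  exists (K + Num.bound (g m))%N => n.
  rewrite ltnS leq_eqVlt natrD => /predU1P[->|/HK gn].
    have g0 : 0 <= g m by rewrite mulr_ge0.
    have := archi_boundP g0; have := ler0n R K; lra.
  have := ler0n R (Num.bound (g m)); lra.
exists K => n; have [/HK gn|Mn] := ltnP n M.+1.
  by have := ler0n R n; rewrite /g in gn; lra.
have n0 : 0 < n%:R :> R by rewrite ltr0n; lia.
have {HM} := HM n (ltnW Mn).
have -> : l - (b n)%:R / n%:R = - ((b n)%:R - l * n%:R) / n%:R :> R.
  by rewrite mulNr mulrBl mulfK ?lt0r_neq0// opprB.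
rewrite normrM normrN normfV (gtr0_norm n0) ler_pdivrMr//.
rewrite ler_pdivlMl ?ltr0n// -addn1 natrD mulrDl mul1r.
have := normr_ge0 ((b n)%:R - l * n%:R); have := ler0n R K; lra.
Qed.

Lemma bound_ratio_cvg (R : realType) (b : nat -> nat) (l : R) :
  (forall N : nat, exists K : nat, forall n,
    N%:R * `|(b n)%:R - l * n%:R| <= n%:R + K%:R) ->
  ratio_cvg b l.
Proof.
move=> bd; apply/cvgrPdist_le => e e0.
(* The factor [2] is there because [n + K] is at most [2 n] once [n] exceeds [K]. *)
set N := Num.bound (2 / e); have [K HK] := bd N.
have eN : 2 / e < N%:R by apply: archi_boundP; rewrite divr_ge0// ltW.
exists K.+1 => // n /= Kn.
have n0 : 0 < n%:R :> R by rewrite ltr0n; lia.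
have Kn' : K%:R <= n%:R :> R by rewrite ler_nat; lia.
have -> : l - (b n)%:R / n%:R = - ((b n)%:R - l * n%:R) / n%:R :> R.
  by rewrite mulNr mulrBl mulfK ?lt0r_neq0// opprB.
rewrite normrM normrN normfV (gtr0_norm n0) ler_pdivrMr//.
have := HK n; rewrite ltr_pdivrMr// in eN.
move: (normr_ge0 ((b n)%:R - l * n%:R)); set x := `|_| => x0 Nx.
have N0 : 0 < N%:R :> R by rewrite -(pmulr_lgt0 _ e0); lra.
rewrite -(ler_pM2l N0) mulrA.
by have := ler_wpM2r (ltW n0) (ltW eN); lra.
Qed.

(** Sublinearity without real numbers or division, so that closure properties become linear
    arithmetic over [nat]. *)
Definition subln (k : nat -> nat) : Prop :=
  forall N, exists K, forall n, (N * k n <= n + K)%N.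

Lemma sublnP (R : realType) (k : nat -> nat) : sublinear R k <-> subln k.
Proof.
split=> [/ratio_cvg_bound bd N|bd].
  have [K HK] := bd N; exists K => n; have := HK n.
  by rewrite mul0r subr0 normr_nat -natrM -natrD ler_nat.
apply: bound_ratio_cvg => N; have [K HK] := bd N; exists K => n.
by rewrite mul0r subr0 normr_nat -natrM -natrD ler_nat.
Qed.

Lemma sublnD (k l : nat -> nat) :
  subln k -> subln l -> subln (fun n => k n + l n)%N.
Proof.
move=> sk sl N; have [K HK] := sk (2 * N)%N; have [L HL] := sl (2 * N)%N.
by exists (K + L)%N => n; have := HK n; have := HL n; lia.
Qed.

Lemma subln_cst (c : nat) : subln (fun=> c).
Proof. by move=> N; exists (N * c)%N => n; lia. Qed.

Lemma sublnM (c : nat) (k : nat -> nat) : subln k -> subln (fun n => c * k n)%N.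
Proof.
by move=> sk N; have [K HK] := sk (N * c)%N; exists K => n; rewrite mulnA.
Qed.

Lemma subln_comp (k g : nat -> nat) (A B : nat) :
  (forall n, (g n <= A * n + B)%N) -> subln k -> subln (k \o g).
Proof.
(* Scaling [N] by [A.+1] pays for the slope of [g]; the successor keeps the factor cancellable when
   [A = 0]. *)
move=> gAB sk N; have [K HK] := sk (N * A.+1)%N; exists (B + K)%N => n /=.
have := HK (g n); have := gAB n; have : (A * n + B <= A.+1 * (n + B))%N by lia.
move=> h1 h2 h3; rewrite -(leq_pmul2l (ltn0Sn A)); nia.
Qed.

(* The majorant is the lower envelope over [N] of the affine-like bounds
   [n %/ N.+1 + 1 + K N] that witness sublinearity; where envelopes at [m] and [n]
   are attained at [M <= N], the bound for [N] serves at [m + n]. *)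
Lemma subln_subadditive_majorant (k : nat -> nat) : subln k ->
  exists f : nat -> nat, [/\ subln f, forall n, (k n <= f n)%N &
    forall m n, (f (m + n) <= f m + f n)%N].
Proof.
move=> sk; have [K HK] := choice (fun N => sk N.+1).
pose P n v := `[< exists N, v = (n %/ N.+1 + 1 + K N)%N >].
have exP n : exists v, P n v.
  by exists (n %/ 1 + 1 + K 0)%N; apply/asboolP; exists 0%N.
pose f n := ex_minn (exP n).
have fle n N : (f n <= n %/ N.+1 + 1 + K N)%N.
  by rewrite /f; case: ex_minnP => v _; apply; apply/asboolP; exists N.
have fE n : exists N, f n = (n %/ N.+1 + 1 + K N)%N.
  by rewrite /f; case: ex_minnP => v /asboolP[N ->] _; exists N.
have divD d m n : (0 < d -> (m + n) %/ d <= m %/ d + n %/ d + 1)%N.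
  by move=> d0; rewrite divnD// leq_add2l leq_b1.
exists f; split.
- move=> N; exists (N * (1 + K N))%N => n.
  have := fle n N; have : (n %/ N.+1 * N.+1 <= n)%N := leq_divM _ _.
  move: (f n) (n %/ N.+1)%N => v q; nia.
- move=> n; have [N ->] := fE n; rewrite -(leq_pmul2l (ltn0Sn N)).
  apply: leq_trans (HK N n) _.
  have := divn_eq n N.+1; have := ltn_pmod n (ltn0Sn N).
  move: (n %/ N.+1)%N (n %% N.+1)%N => q r; nia.
- move=> m n; have [M fM] := fE m; have [N fN] := fE n.
  wlog MN : m n M N fM fN / (M <= N)%N.
    move=> H; have [/H|/ltnW/H] := leqP M N; first exact.
    by rewrite addnC [(f m + _)%N]addnC; apply.
  have mMN : (m %/ N.+1 <= m %/ M.+1)%N by exact: leq_div2l.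
  rewrite fM fN; apply: leq_trans (fle _ N) _.
  move: (divD N.+1 m n (ltn0Sn N)) mMN.
  by move: (_ %/ _)%N (_ %/ _)%N (_ %/ _)%N (_ %/ _)%N => p q r s; lia.
Qed.

(** The empty sum is excluded because subadditivity allows [f 0] to be positive. *)
Lemma subadditive_sum (f : nat -> nat) :
  (forall m n, f (m + n) <= f m + f n)%N ->
  forall t (m : 'I_t -> nat), (0 < t)%N ->
  (f (\sum_(i < t) m i) <= \sum_(i < t) f (m i))%N.
Proof.
move=> fD [//|t] m _; elim: t m => [|t IH] m; first by rewrite !big_ord1.
by rewrite big_ord_recl [leqRHS]big_ord_recl (leq_trans (fD _ _))// leq_add2l IH.
Qed.

(** The real deviation from the line of slope [l] is rounded up to a natural number, which costs
    only a constant. *)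
Lemma ratio_cvg_error (R : realType) (b : nat -> nat) (l : R) :
  ratio_cvg b l ->
  exists2 e : nat -> nat, subln e & forall n, `|(b n)%:R - l * n%:R| <= (e n)%:R.
Proof.
move=> /ratio_cvg_bound bd; exists (fun n => (Num.truncn `|(b n)%:R - l * n%:R|%R + 1)%N).
  apply: (sublnD _ (subln_cst 1)) => N; have [K HK] := bd N; exists K => n.
  rewrite -(ler_nat R) natrM natrD (le_trans _ (HK n))// ler_wpM2l//.
  by rewrite truncn_le.
by move=> n; rewrite addn1 ltW// truncnS_gt.
Qed.

Lemma ratio_cvg_linear (R : realType) (b : nat -> nat) (l : R) :
  ratio_cvg b l -> exists A B, forall n, (b n <= A * n + B)%N.
Proof.
move=> /ratio_cvg_bound /(_ 1%N) [K HK].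
exists (Num.bound `|l| + 1)%N, K => n; rewrite -(ler_nat R) natrD natrM natrD.
have := HK n; rewrite mul1r => h.
have h1 : l * n%:R <= (Num.bound `|l|)%:R * n%:R.
  by rewrite ler_wpM2r// (le_trans (ler_norm _))// ltW// archi_boundP.
have := ler_norm ((b n)%:R - l * n%:R); lra.
Qed.

Lemma ratio_cvg_same (R : realType) (b c : nat -> nat) (l : R) :
  ratio_cvg b l -> ratio_cvg c l ->
  exists2 d : nat -> nat, subln d &
    forall n, (b n <= c n + d n)%N /\ (c n <= b n + d n)%N.
Proof.
move=> /ratio_cvg_error[d sd bd] /ratio_cvg_error[e se ce].
exists (fun n => d n + e n)%N; first exact: sublnD.
move=> n; rewrite -!(ler_nat R) !natrD.
have := bd n; have := ce n; rewrite !ler_norml => /andP[? ?] /andP[? ?].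
by split; lra.
Qed.

(** The linear part of [b] is exactly additive, so only errors remain. One copy of the subadditive
    majorant bounds the error at the total index, the other the errors at the separate [m i]. *)
Lemma ratio_cvg_sum (R : realType) (b : nat -> nat) (l : R) :
  ratio_cvg b l ->
  exists2 f : nat -> nat, subln f & forall t (m : 'I_t -> nat), (0 < t)%N ->
    (b (\sum_(i < t) m i) <= \sum_(i < t) b (m i) + \sum_(i < t) f (m i))%N /\
    (\sum_(i < t) b (m i) <= b (\sum_(i < t) m i) + \sum_(i < t) f (m i))%N.
Proof.
move=> /ratio_cvg_error[e se be].
have [f [sf ef fD]] := subln_subadditive_majorant se.
exists (fun n => f n + f n)%N; first exact: sublnD.
move=> t m t0; rewrite big_split/=; have fS := subadditive_sum fD m t0.
have {}be n : `|(b n)%:R - l * n%:R| <= (f n)%:R.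
  by rewrite (le_trans (be n))// ler_nat.
have bS : `|(\sum_(i < t) b (m i))%N%:R - l * (\sum_(i < t) m i)%N%:R|
    <= (\sum_(i < t) f (m i))%N%:R.
  rewrite !natr_sum mulr_sumr -sumrB (le_trans (ler_norm_sum _ _ _))//.
  by apply: ler_sum => i _; exact: be.
have := be (\sum_(i < t) m i)%N; move: bS fS; rewrite -!(ler_nat R) !natrD.
move: (\sum_(i < t) m i)%N => s; rewrite !ler_norml => /andP[? ?] ? /andP[? ?].
by split; lra.
Qed.

(** * Comparison up to powers of the power universal element *)

Section LeUpto.
Context (S : comPzSemiRingType) (le : S -> S -> Prop) (u : S).
Context (hS : preordered_semiring le) (hu : power_universal le u).

(** An asymmetric distance bound on the logarithmic scale with base [u]; [le_upto_trans] is its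
    triangle inequality. *)
Definition le_upto (k : nat) (x y : S) : Prop := le x (u ^+ k * y).

Definition comparable_upto (x y : S) : Prop :=
  exists k, le_upto k x y /\ le_upto k y x.

Lemma le_mul2 x y z w : le x y -> le z w -> le (x * z) (y * w).
Proof.
move=> xy zw; apply: (preordered_trans hS) (preordered_mul hS y zw).
by rewrite ![_ * z]mulrC; exact: preordered_mul.
Qed.

Lemma le1X k : le 1 (u ^+ k).
Proof.
elim: k => [|k IH]; first by rewrite expr0; exact: preordered_refl hS _.
by rewrite exprS -[1]mulr1; exact: le_mul2 (power_universal_ge1 hu) IH.
Qed.

Lemma le_upto_weak k l x y : (k <= l)%N -> le_upto k x y -> le_upto l x y.
Proof.
move=> kl xy; rewrite /le_upto -(subnK kl) exprD -mulrA -[x]mul1r.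
exact: le_mul2 (le1X _) xy.
Qed.

Lemma le_upto0 x y : le x y -> le_upto 0 x y.
Proof. by rewrite /le_upto expr0 mul1r. Qed.

Lemma le_upto_refl k x : le_upto k x x.
Proof. exact: le_upto_weak (leq0n k) (le_upto0 (preordered_refl hS x)). Qed.

Lemma le_upto_trans k l x y z :
  le_upto k x y -> le_upto l y z -> le_upto (k + l) x z.
Proof.
move=> xy yz; apply: (preordered_trans hS) xy _.
by rewrite exprD -mulrA; exact: preordered_mul.
Qed.

Lemma le_upto_mul k l x y z w :
  le_upto k x y -> le_upto l z w -> le_upto (k + l) (x * z) (y * w).
Proof. by move=> xy zw; rewrite /le_upto exprD mulrACA; exact: le_mul2. Qed.

Lemma le_upto_exp k n x y : le_upto k x y -> le_upto (n * k) (x ^+ n) (y ^+ n).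
Proof.
move=> xy; elim: n => [|n IH]; first exact: le_upto_refl.
by rewrite !exprS mulSn; exact: le_upto_mul.
Qed.

Lemma comparable_upto_refl x : comparable_upto x x.
Proof. by exists 0%N; split; exact: le_upto_refl. Qed.

Lemma comparable_upto_sym x y : comparable_upto x y -> comparable_upto y x.
Proof. by move=> [k [? ?]]; exists k. Qed.

Lemma comparable_upto_trans x y z :
  comparable_upto x y -> comparable_upto y z -> comparable_upto x z.
Proof.
move=> [k [xy yx]] [l [yz zy]]; exists (k + l)%N; split.
  exact: le_upto_trans xy yz.
by rewrite addnC; exact: le_upto_trans zy yx.
Qed.

Lemma comparable_upto_le x y :
  x != 0 -> y != 0 -> le x y -> comparable_upto x y.
Proof.
move=> x0 y0 xy; have [k yx] := power_universal_bound hu x0 y0 xy.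
by exists k; split=> //; exact: le_upto_weak (leq0n k) (le_upto0 xy).
Qed.

(* A chain of comparisons between nonzero elements may pass through [0]; it is
   rerouted through [x + y], which is comparable to both [x] and [y]. *)
Lemma comparable_upto_via0 x y : x != 0 -> y != 0 ->
  le x 0 \/ le 0 x -> le y 0 \/ le 0 y -> comparable_upto x y.
Proof.
move=> x0 y0.
have addl z w : le z 0 -> le (w + z) w.
  by move=> h; rewrite -[X in le _ X]addr0; exact: preordered_add.
have addr z w : le 0 z -> le w (w + z).
  by move=> h; rewrite -[X in le X _]addr0; exact: preordered_add.
have tr := preordered_trans hS.
case=> hx; case=> hy.
- have [xy0|xy0] := eqVneq (x + y) 0.
    apply: comparable_upto_le => //; apply: (tr _ _ _ hx).
    by rewrite -xy0 addrC; exact: addl.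
  apply: (@comparable_upto_trans _ (x + y)).
    by apply/comparable_upto_sym/comparable_upto_le => //; exact: addl.
  by apply: comparable_upto_le => //; rewrite addrC; exact: addl.
- by apply: comparable_upto_le => //; exact: tr hx hy.
- by apply/comparable_upto_sym/comparable_upto_le => //; exact: tr hy hx.
- have [xy0|xy0] := eqVneq (x + y) 0.
    apply: comparable_upto_le => //; apply: (tr _ _ _ _ hy).
    by rewrite -xy0; exact: addr.
  apply: (@comparable_upto_trans _ (x + y)).
    by apply: comparable_upto_le => //; exact: addr.
  by apply/comparable_upto_sym/comparable_upto_le => //; rewrite addrC; exact: addr.
Qed.

Lemma comparable_upto_equiv x y :
  x != 0 -> y != 0 -> generated_equiv le x y -> comparable_upto x y.
Proof.
move=> x0 y0 xy_equiv; have xy := clos_rst_rstn1 _ _ _ _ xy_equiv.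
(* Induction along the chain: whenever it stands at [0], the invariant remembers the last nonzero
   element [w] before it, from which the chain can be resumed without passing through [0]. *)
suff : if y == 0 then exists2 w, w != 0 & comparable_upto x w /\ (le w 0 \/ le 0 w)
      else comparable_upto x y by rewrite (negPf y0).
elim: {y y0 xy_equiv} xy => [|y z yz _]; first by rewrite (negPf x0); exact: comparable_upto_refl.
have [y0|y0] := eqVneq y 0; have [z0|z0] := eqVneq z 0 => //.
- move=> [w w0 [xw w0le]]; apply: comparable_upto_trans xw _.
  by apply: comparable_upto_via0 => //; rewrite -y0; case: yz; [right|left].
- by move=> xy; exists y => //; split=> //; rewrite -z0.
- move=> xy; apply: comparable_upto_trans xy _.
  case: yz => h; first exact: comparable_upto_le.
  exact/comparable_upto_sym/comparable_upto_le.
Qed.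

(* If [a] is asymptotically [G(0)] then [a 1] is simultaneously comparable up to
   powers of [u] to [0] and to [1], which makes the preorder trivial up to a
   fixed power of [u]. *)
Lemma asymp_geometric0_collapse (R : realType) (a : nat -> S) :
  comparable_upto (a 1%N) 1 -> asymp_eq R le u a (geometric_seq 0) ->
  forall x y : nat -> S, asymp_eq R le u x y.
Proof.
move=> [m [a1 le1a]] [[k _ /(_ 1%N) ak] [l _ /(_ 1%N) al]].
rewrite /geometric_seq expr1 ?mulr0 in ak al.
have le10 : le 1 0.
  apply: (preordered_trans hS) le1a _.
  by rewrite -[X in le _ X](mulr0 (u ^+ m)); exact: preordered_mul.
have le0 x : le x 0.
  by rewrite -[x]mulr1 -[X in le _ X](mulr0 x); exact: preordered_mul.
have ge0 x : le_upto (l 1%N + m) 0 x.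
  have := preordered_mul hS x (le_upto_trans al a1).
  by rewrite mulr0 mulr1 mulrC.
have H x y : asymp_le R le u x y.
  exists (fun=> l 1%N + m)%N; first exact/sublnP/subln_cst.
  by move=> n; exact: (preordered_trans hS) (le0 _) (ge0 _).
by move=> x y; split.
Qed.

(** * Sequences that are multiplicative up to a sublinear error *)

Section ApproxMultiplicative.
Context (a : nat -> S) (k : nat -> nat).
Context (a1 : comparable_upto (a 1%N) 1).
Context (ak : forall t (m : 'I_t -> nat), (0 < t)%N ->
  le_upto (\sum_(i < t) k (m i)) (\prod_(i < t) a (m i)) (a (\sum_(i < t) m i)%N) /\
  le_upto (\sum_(i < t) k (m i)) (a (\sum_(i < t) m i)%N) (\prod_(i < t) a (m i))).

Lemma approx_mul2 m n :
  le_upto (k m + k n) (a m * a n) (a (m + n)%N) /\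
  le_upto (k m + k n) (a (m + n)%N) (a m * a n).
Proof.
pose f (i : 'I_2) := if i == ord0 then m else n.
by have := ak f isT; rewrite !big_ord_recl !big_ord0 /= ?addn0 mulr1.
Qed.

Lemma approx_exp t n : (0 < t)%N ->
  le_upto (t * k n) (a n ^+ t) (a (t * n)%N) /\
  le_upto (t * k n) (a (t * n)%N) (a n ^+ t).
Proof.
move=> t0; have := ak (fun=> n) t0.
by rewrite !sum_nat_const prodr_const !card_ord.
Qed.

(** Since [0 + 1 = 1], the product of [a 0] and [a 1] is comparable to [a 1], hence to [1];
    replacing its factor [a 1] by [1] leaves [a 0]. *)
Lemma approx_zero : comparable_upto (a 0%N) 1.
Proof.
have [h1 h2] := approx_mul2 0 1; rewrite add0n in h1 h2.
have a0a1 : comparable_upto (a 0%N * a 1%N) 1.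
  by apply: comparable_upto_trans a1; exists (k 0 + k 1)%N.
apply: comparable_upto_trans a0a1; have [m [h3 h4]] := a1.
exists m; split.
  by rewrite -[X in le_upto _ X _]mulr1; exact: (le_upto_mul (le_upto_refl 0 _)).
by rewrite -[X in le_upto _ _ X]mulr1; exact: (le_upto_mul (le_upto_refl 0 _)).
Qed.

(** For positive [n], [a n] is close to the [n]-th power of [a 1], and each factor [a 1] is a
    bounded power of [u] away from [1]. *)
Lemma approx_linear : exists C, forall n,
  le_upto (C * n.+1) (a n) 1 /\ le_upto (C * n.+1) 1 (a n).
Proof.
have [c [c1 c2]] := approx_zero; have [m [m1 m2]] := a1.
exists (c + k 1 + m)%N => -[|n].
  by split; [apply: le_upto_weak c1|apply: le_upto_weak c2]; lia.
have [h1 h2] := approx_exp 1 (ltn0Sn n); rewrite muln1 in h1 h2.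
have h3 := le_upto_trans h2 (le_upto_exp n.+1 m1).
have h4 := le_upto_trans (le_upto_exp n.+1 m2) h1.
rewrite expr1n in h3 h4.
by split; [apply: le_upto_weak h3|apply: le_upto_weak h4]; nia.
Qed.

Lemma approx_lipschitz : subln k -> exists C, forall x y d,
  (x <= y + d)%N -> (y <= x + d)%N ->
  le_upto (k x + k y + C * d.+1) (a x) (a y).
Proof.
move=> /(_ 1%N)[K HK]; have [C HC] := approx_linear.
(* The larger index is split as the smaller plus the difference. The difference costs [C] per unit
   by [approx_linear], and its own [k]-term is at most the difference plus [K]. *)
exists (C + K + 1)%N => x y d xy yx.
have [yx'|/ltnW xy'] := leqP y x.
  have [_ h1] := approx_mul2 y (x - y); have [h2 _] := HC (x - y)%N.
  have := le_upto_trans h1 (le_upto_mul (le_upto_refl 0 (a y)) h2).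
  rewrite subnKC// mulr1; apply: le_upto_weak.
  by have := HK (x - y)%N; nia.
have [h1 _] := approx_mul2 x (y - x); have [_ h2] := HC (y - x)%N.
have := le_upto_trans (le_upto_mul (le_upto_refl 0 (a x)) h2) h1.
rewrite subnKC// mulr1; apply: le_upto_weak.
by have := HK (y - x)%N; nia.
Qed.

Lemma approx_multiplicative_comp (R : realType) (b : nat -> nat) (l : R) :
  subln k -> ratio_cvg b l ->
  exists2 k' : nat -> nat, subln k' & forall t (m : 'I_t -> nat), (0 < t)%N ->
    le_upto (\sum_(i < t) k' (m i)) (\prod_(i < t) a (b (m i)))
      (a (b (\sum_(i < t) m i)%N)) /\
    le_upto (\sum_(i < t) k' (m i)) (a (b (\sum_(i < t) m i)%N))
      (\prod_(i < t) a (b (m i))).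
Proof.
move=> sk cvb; have [A [B bAB]] := ratio_cvg_linear cvb.
have [C HC] := approx_lipschitz sk; have [f sf bf] := ratio_cvg_sum cvb.
have [g [sg kg gD]] := subln_subadditive_majorant sk.
have [h [sh kh hD]] := subln_subadditive_majorant (subln_comp bAB sk).
(* [k (b n)] pays for merging the factors. [g] and [h] bound the two Lipschitz terms [k] at the sum
   of the [b (m i)] and at [b] of the sum. The rest pays for the gap between these indices; its
   [+ 1], counted [t] times, covers the successor because [t] is positive. *)
exists (fun n => (k (b n) + g (b n)) + (h n + C * (f n + 1)))%N.
  by do !apply: sublnD; rewrite //; [exact: subln_comp bAB sk|
    exact: subln_comp bAB sg|apply: sublnM; apply: sublnD => //; exact: subln_cst].
move=> t m t0; have [h1 h2] := ak (b \o m) t0; have [bm1 bm2] := bf t m t0.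
have h3 := HC _ _ _ bm2 bm1; have h4 := HC _ _ _ bm1 bm2.
have kb : (k (\sum_(i < t) b (m i)) <= \sum_(i < t) g (b (m i)))%N.
  exact: leq_trans (kg _) (subadditive_sum gD (b \o m) t0).
have kbS : (k (b (\sum_(i < t) m i)) <= \sum_(i < t) h (m i))%N.
  exact: leq_trans (kh _) (subadditive_sum hD m t0).
rewrite !big_split/= -big_distrr/= big_split/= sum_nat_const card_ord muln1.
have Cf : (C * (\sum_(i < t) f (m i)).+1 <= C * (\sum_(i < t) f (m i) + t))%N.
  by rewrite leq_mul2l -addn1 leq_add2l t0 orbT.
have kS := leq_add (leq_add kb kbS) Cf.
split; [apply: le_upto_weak (le_upto_trans h1 h3) |
        apply: le_upto_weak (le_upto_trans h4 h2)] => /=; last first.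
  rewrite addnC [(k (b _) + _)%N]addnC.
  by rewrite -!addnA leq_add2l !addnA.
by rewrite -!addnA leq_add2l !addnA.
Qed.

Lemma approx_comp_close (R : realType) (b c : nat -> nat) (l : R) :
  subln k -> ratio_cvg b l -> ratio_cvg c l ->
  asymp_le R le u (a \o b) (a \o c).
Proof.
move=> sk cvb cvc; have [d sd bcd] := ratio_cvg_same cvb cvc.
have [A [B bAB]] := ratio_cvg_linear cvb.
have [A' [B' cAB]] := ratio_cvg_linear cvc.
have [C HC] := approx_lipschitz sk.
exists (fun n => k (b n) + k (c n) + C * (d n + 1))%N.
  apply/sublnP; apply: sublnD; last by apply/sublnM/sublnD => //; exact: subln_cst.
  by apply: sublnD; [exact: subln_comp bAB sk|exact: subln_comp cAB sk].
by move=> n; rewrite addn1; have [bc cb] := bcd n; exact: HC bc cb.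
Qed.

Lemma approx_comp_mul (R : realType) (d : nat) : subln k ->
  asymp_eq R le u (a \o muln d) (fun n => a n ^+ d).
Proof.
(* Merging needs at least one factor, so exponent [0] is treated separately through
   [approx_zero]. *)
move=> sk; case: d => [|d].
  by have [c [c1 c2]] := approx_zero; split; exists (fun=> c) => //;
    exact/sublnP/subln_cst.
by split; (exists (fun n => d.+1 * k n)%N; first exact/sublnP/sublnM) => n;
  have [? ?] := approx_exp n (ltn0Sn d).
Qed.

Lemma approx_comp_add (R : realType) (b c : nat -> nat) (lb lc : R) :
  subln k -> ratio_cvg b lb -> ratio_cvg c lc ->
  asymp_eq R le u (a \o (fun n => b n + c n)%N) (seq_mul (a \o b) (a \o c)).
Proof.
move=> sk cvb cvc; have [A [B bAB]] := ratio_cvg_linear cvb.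
have [A' [B' cAB]] := ratio_cvg_linear cvc.
by split; (exists (fun n => k (b n) + k (c n))%N;
  first by apply/sublnP; apply: sublnD; [exact: subln_comp bAB sk|exact: subln_comp cAB sk])
  => n; have [? ?] := approx_mul2 (b n) (c n).
Qed.

End ApproxMultiplicative.

(** * Transitivity and reindexing of asymptotic comparison *)

Lemma asymp_eq_trans (R : realType) (x y z : nat -> S) :
  asymp_eq R le u x y -> asymp_eq R le u y z -> asymp_eq R le u x z.
Proof.
have tr (p q r : nat -> S) :
    asymp_le R le u p q -> asymp_le R le u q r -> asymp_le R le u p r.
  move=> [k /sublnP sk pq] [l /sublnP sl qr]; exists (fun n => k n + l n)%N.
    exact/sublnP/sublnD.
  by move=> n; exact: le_upto_trans (pq n) (qr n).
by move=> [xy yx] [yz zy]; split; [exact: tr xy yz|exact: tr zy yx].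
Qed.

Lemma asymp_le_comp (R : realType) (x y : nat -> S) (c : nat -> nat) (l : R) :
  ratio_cvg c l -> asymp_le R le u x y -> asymp_le R le u (x \o c) (y \o c).
Proof.
move=> /ratio_cvg_linear[A [B cAB]] [k /sublnP sk xy].
by exists (k \o c) => [|n]; [exact/sublnP/(subln_comp cAB sk)|exact: xy].
Qed.

End LeUpto.

(** * The six claims, by cases on the form of [a] *)

Lemma ratio_cvg_muln (R : realType) (d : nat) : ratio_cvg (muln d) (d%:R : R).
Proof.
apply: bound_ratio_cvg => N; exists 0%N => n.
by rewrite natrM subrr normr0 mulr0 addr0.
Qed.

Theorem proposition5p2 (R : realType) (S : comPzSemiRingType)
    (le : S -> S -> Prop) (u : S) (a b : nat -> S)
    (beta gamma : nat -> nat) (lbeta lgamma : R)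
    (hS : preordered_semiring le) (hu : power_universal le u)
    (ha : approx_geometric R le u a) (hb : approx_geometric R le u b)
    (ha1 : a 1%N != 0) (ha1' : generated_equiv le (a 1%N) 1)
    (hb1 : b 1%N != 0) (hb1' : generated_equiv le (b 1%N) 1)
    (hbeta : ratio_cvg beta lbeta) (hgamma : ratio_cvg gamma lgamma) :
  approx_geometric R le u (a \o beta) /\
  (lbeta = lgamma -> asymp_eq R le u (a \o beta) (a \o gamma)) /\
  asymp_eq R le u (a \o (fun n => (beta n + gamma n)%N))
    (seq_mul (a \o beta) (a \o gamma)) /\
  seq_mul a b \o beta = seq_mul (a \o beta) (b \o beta) /\
  (asymp_le R le u a b -> asymp_le R le u (a \o gamma) (b \o gamma)) /\
  (forall d : nat, lbeta = d%:R ->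
    asymp_eq R le u (a \o beta) (fun n => a n ^+ d)).
Proof.
have one_neq0 : 1 != 0 :> S.
  apply: contraNneq (power_universal_neq0 hu) => S1.
  by rewrite -[u]mulr1 S1 mulr0.
have a1E := comparable_upto_equiv hS hu ha1 one_neq0 ha1'.
have comp_le : asymp_le R le u a b -> asymp_le R le u (a \o gamma) (b \o gamma).
  exact: asymp_le_comp hgamma.
case: ha => [a0|[anz [k /sublnP sk ak]]].
  have coll := asymp_geometric0_collapse hS a1E a0.
  split; first by left; exact: coll.
  split=> [_|]; first exact: coll.
  split; first exact: coll.
  by split=> //; split=> // d _; exact: coll.
split.
  right; split=> [n|]; first exact: anz.
  have [k' sk' ak'] := approx_multiplicative_comp hS hu a1E ak sk hbeta.
  by exists k'; [exact/sublnP|exact: ak'].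
have close := approx_comp_close hS hu a1E ak.
split=> [lE|].
  rewrite -lE in hgamma.
  by split; [exact: close sk hbeta hgamma|exact: close sk hgamma hbeta].
split; first exact: (approx_comp_add ak sk hbeta hgamma).
do 2!split=> //.
(* [beta] is first replaced by multiplication by [d], which has the same ratio; there the exponent
   [d] comes out directly. *)
move=> d lE; apply: (asymp_eq_trans hS (y := a \o muln d)).
  rewrite lE in hbeta; have hd := @ratio_cvg_muln R d.
  by split; [exact: close sk hbeta hd|exact: close sk hd hbeta].
exact: (approx_comp_mul hS hu a1E ak).
Qed.
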